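(* There exist functions $f\colon\mathbb{T}^\omega\to\mathbb{C}$ of class $C^{(\infty}(\mathbb{T}^\omega)$, depending on an infinite number of variables (i.e. not cylindrical), whose Fourier series diverges absolutely, that is, $$\sum_{\bar p\in\mathbb{Z}^\infty}\bigl|\widehat f(\bar p)\bigr|=\infty .$$
   Context: $\mathbb{T}\simeq\mathbb{R}/\mathbb{Z}$, and $\mathbb{T}^\omega$ is the infinite dimensional torus, i.e. the product of countably many copies of $\mathbb{T}$, a compact abelian group with the product topology; $dx$ is its normalized Haar measure. Points are written $x=(x_1,x_2,\ldots)$. A function $f$ on $\mathbb{T}^\omega$ is cylindrical if it depends only on finitely many variables, i.e. there are $n\ge 1$ and a function $g_n$ on $\mathbb{T}^n$ with $f=g_n\circ\pi_n$, where $\pi_n\colon\mathbb{T}^\omega\to\mathbb{T}^n$ is the projection on the first $n$ coordinates. $C^{(0}(\mathbb{T}^\omega)$ is the space of continuous functions $\mathbb{T}^\omega\to\mathbb{C}$. For each finitely nonzero multiindex $\alpha=(\alpha_1,\alpha_2,\ldots)$ of nonnegative integers, with $\alpha_j=0$ for $j\notin\{j_1,\ldots,j_m\}$, put $D^\alpha f=\frac{\partial^{\alpha_{j_1}}}{\partial x_{j_1}^{\alpha_{j_1}}}\cdots\frac{\partial^{\alpha_{j_m}}}{\partial x_{j_m}^{\alpha_{j_m}}}f$ and $|\alpha|=\alpha_{j_1}+\cdots+\alpha_{j_m}$ (with $D^\alpha f=f$ if $|\alpha|=0$). $C^{(k}(\mathbb{T}^\omega)$ is the class of all functions $f$ such that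 $D^\alpha f$ exists and belongs to $C^{(0}(\mathbb{T}^\omega)$ for all finitely nonzero $\alpha$ with $|\alpha|\le k$, and $C^{(\infty}(\mathbb{T}^\omega)=\bigcap_{k=0}^\infty C^{(k}(\mathbb{T}^\omega)$. $\mathbb{Z}^\infty$ is the (countable) group of finitely nonzero sequences of integers, the dual group of $\mathbb{T}^\omega$. For $f\in L^1(\mathbb{T}^\omega)$ and $\bar p\in\mathbb{Z}^\infty$, $\widehat f(\bar p)=\int_{\mathbb{T}^\omega}f(x)e^{-2\pi i\bar p\cdot x}\,dx$, where $\bar p\cdot x=\sum_j p_jx_j$. The Fourier series of $f$ is $\sum_{\bar p\in\mathbb{Z}^\infty}\widehat f(\bar p)e^{2\pi i\bar p\cdot x}$. *)

(* Defs.v *)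
From HB Require Import structures.
From mathcomp Require Import all_boot all_order all_algebra.
From mathcomp Require Import generic_quotient ring_quotient finmap complex.
From mathcomp Require Import all_classical all_reals all_analysis.
Set Implicit Arguments.
Unset Strict Implicit.
Unset Printing Implicit Defensive.
Import Order.TTheory GRing.Theory Num.Theory.
Import numFieldNormedType.Exports.
Local Open Scope ring_scope.
Local Open Scope complex_scope.
Local Open Scope classical_set_scope.
Local Open Scope quotient_scope.

(* MathComp-Analysis does not attach the norm topology to R[i] by itself. *)
HB.instance Definition _ (R : rcfType) := NormedModule.copy R[i] R[i]^o.

(* The group R/Z; \pi_(circle R) : R -> circle R is the projection. *)
Definition circle (R : realType) : Type :=
  quotient_topology {ideal_quot (Num.int_num_subdef : {pred R})}.

HB.instance Definition _ (R : realType) :=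
  GRing.Zmodule.copy (circle R) {ideal_quot (Num.int_num_subdef : {pred R})}.
HB.instance Definition _ (R : realType) := Topological.on (circle R).
HB.instance Definition _ (R : realType) := Pointed.on (circle R).
HB.instance Definition _ (R : realType) := Quotient.on (circle R).

(* Coordinates are numbered from 0. *)
Definition torus (R : realType) : Type :=
  prod_topology (fun _ : nat => circle R).

HB.instance Definition _ (R : realType) := Topological.on (torus R).
HB.instance Definition _ (R : realType) := Pointed.on (torus R).

Definition borel_torus (R : realType) :=
  g_sigma_algebraType (@open (torus R)).

Definition translate (R : realType) (a x : torus R) : torus R :=
  fun i => x i + a i.

(* A Borel probability on the compact metrizable group T^omega is
   automatically regular, so invariance characterizes Haar measure. *)
Definition is_haar (R : realType) (mu : probability (borel_torus R) R) : Prop :=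
  forall (a : torus R) (A : set (borel_torus R)),
    measurable A -> mu (translate a @^-1` A) = mu A.

Definition multiindex := {fsfun nat -> nat with 0%N}.

Definition Zinf := {fsfun nat -> int with (0 : int)}.

Section functions.
Variable R : realType.
Implicit Types (f : torus R -> R[i]) (x : torus R).

Definition cylindrical f : Prop :=
  exists (n : nat) (g : ('I_n -> circle R) -> R[i]),
    (1 <= n)%N /\ f = g \o (fun x (i : 'I_n) => x i).

(* x + h e_j *)
Definition shift_coord (j : nat) x (h : R) : torus R :=
  dfwith x j (x j + \pi_(circle R) h).

Definition diff_quot (j : nat) f x (h : R) : R[i] :=
  (h^-1)%:C * (f (shift_coord j x h) - f x).

Definition has_partial (j : nat) f : Prop :=
  forall x, cvg (diff_quot j f x h @[h --> (0 : R)^']).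

(* Only meaningful under has_partial j f. *)
Definition partial (j : nat) f : torus R -> R[i] :=
  fun x => lim (diff_quot j f x h @[h --> (0 : R)^']).

(* partials [:: i1; ...; ik] f is d/dx_i1 (... (d/dx_ik f)). *)
Definition partials (s : seq nat) f : torus R -> R[i] := foldr partial f s.

Fixpoint has_partials (s : seq nat) f : Prop :=
  if s is j :: s' then has_partials s' f /\ has_partial j (partials s' f)
  else True.

(* Each j of the support, in increasing order, repeated alpha_j times. *)
Definition directions (alpha : multiindex) : seq nat :=
  flatten [seq nseq (alpha j) j | j <- sort leq (finsupp alpha)].

Definition multi_length (alpha : multiindex) : nat :=
  (\sum_(j <- finsupp alpha) alpha j)%N.

Definition classC (k : nat) f : Prop :=
  forall alpha : multiindex, (multi_length alpha <= k)%N ->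
    has_partials (directions alpha) f /\
    continuous (partials (directions alpha) f).

Definition classCinfty f : Prop := forall k : nat, classC k f.

(* t |-> e^(2 pi i t) on R/Z; independent of the representative. *)
Definition expi2pi (t : circle R) : R[i] :=
  cos (2 * pi * repr t) +i* sin (2 * pi * repr t).

Definition dot (p : Zinf) x : circle R := \sum_(j <- finsupp p) x j *~ p j.

Definition cintegral (mu : probability (borel_torus R) R)
    (f : borel_torus R -> R[i]) : R[i] :=
  (\int[mu]_(x in setT) complex.Re (f x)) +i*
  (\int[mu]_(x in setT) complex.Im (f x)).

Definition fourier_coef (mu : probability (borel_torus R) R) f (p : Zinf)
    : R[i] :=
  cintegral mu (fun x => f x * expi2pi (- dot p x)).

End functions.

(* Main.v *)
(* With z_j = e^(2 pi i x_j) take F(x) = sum_n prod_(j < n) (2/5) q(z_j), where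
   q(z) = z + i z^2 + z^3.  On the circle |q| <= sqrt 5 <= 9/4, so the n-th term is
   at most (9/10)^n.  Differentiating in x_j discards the terms with n <= j and
   replaces one factor by its derivative, so the partial derivatives of F are
   series of the same shape, with finitely many modified factors, and still
   converge uniformly.  As q has mean zero, a frequency p in {1,2,3}^N x 0 only
   meets the N-th term of F and its Fourier coefficient has modulus (2/5)^N; the
   3^N such frequencies contribute (6/5)^N, which is unbounded. *)

Require Import Defs.
From mathcomp Require Import all_boot all_order all_algebra.
From mathcomp Require Import generic_quotient ring_quotient finmap complex.
From mathcomp Require Import all_classical all_reals all_analysis.
From mathcomp Require Import measurable_realfun ring lra zify.
Set Implicit Arguments.
Unset Strict Implicit.
Unset Printing Implicit Defensive.
Import Order.TTheory GRing.Theory Num.Theory.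
Import numFieldNormedType.Exports.
Import ComplexField.Normc.
Local Open Scope classical_set_scope.
Local Open Scope ring_scope.
Local Open Scope complex_scope.
Local Open Scope quotient_scope.

(** * The modulus on [R[i]]; limits and continuity through real and imaginary parts *)

Lemma normE (R : rcfType) (z : R[i]) : `|z| = (normc z)%:C.
Proof. by case: z. Qed.

Lemma normc_ge0 (R : rcfType) (z : R[i]) : 0 <= normc z.
Proof. by case: z => a b /=; rewrite sqrtr_ge0. Qed.

Lemma normcX (R : rcfType) (z : R[i]) n : normc (z ^+ n) = normc z ^+ n.
Proof. by elim: n => [|n IH]; [rewrite !expr0 normc1 | rewrite !exprS normcM IH]. Qed.

Lemma ler_normcD (R : rcfType) (z w : R[i]) : normc (z + w) <= normc z + normc w.
Proof.
have := ler_normD z w; rewrite !normE -rmorphD /= lecR //.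
Qed.

Lemma normc_prod (R : rcfType) (I : Type) (s : seq I) (P : pred I) (F : I -> R[i]) :
  normc (\prod_(i <- s | P i) F i) = \prod_(i <- s | P i) normc (F i).
Proof. exact: (big_morph _ (@normcM R) (@normc1 R)). Qed.

Lemma ler_Re_normc (R : rcfType) (z : R[i]) : `|complex.Re z| <= normc z.
Proof. by case: z => a b /=; rewrite -sqrtr_sqr ler_wsqrtr // lerDl sqr_ge0. Qed.

Lemma ler_Im_normc (R : rcfType) (z : R[i]) : `|complex.Im z| <= normc z.
Proof. by case: z => a b /=; rewrite -sqrtr_sqr ler_wsqrtr // lerDr sqr_ge0. Qed.

Lemma ReD (R : rcfType) (z w : R[i]) : complex.Re (z + w) = complex.Re z + complex.Re w.
Proof. by case: z; case: w. Qed.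
Lemma ImD (R : rcfType) (z w : R[i]) : complex.Im (z + w) = complex.Im z + complex.Im w.
Proof. by case: z; case: w. Qed.
Lemma continuous_Re (R : realType) : continuous (@complex.Re R : R[i] -> R).
Proof.
move=> z; apply: (@cvgrPdist_lt _ _ _ _ (nbhs_filter z) _ _).2 => e e0.
have := @cvgrPdist_lt _ _ _ _ (nbhs_filter z) (id : R[i] -> R[i]^o) z.
move=> [/(_ cvg_id)/(_ e%:C) + _].
rewrite ltcR => /(_ e0); apply: filterS => w /=; rewrite normE ltcR.
apply: le_lt_trans; rewrite (_ : _ - _ = complex.Re (z - w)) ?ler_Re_normc //.
by case: (z); case: (w).
Qed.

Lemma continuous_Im (R : realType) : continuous (@complex.Im R : R[i] -> R).
Proof.
move=> z; apply: (@cvgrPdist_lt _ _ _ _ (nbhs_filter z) _ _).2 => e e0.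
have := @cvgrPdist_lt _ _ _ _ (nbhs_filter z) (id : R[i] -> R[i]^o) z.
move=> [/(_ cvg_id)/(_ e%:C) + _].
rewrite ltcR => /(_ e0); apply: filterS => w /=; rewrite normE ltcR.
apply: le_lt_trans; rewrite (_ : _ - _ = complex.Im (z - w)) ?ler_Im_normc //.
by case: (z); case: (w).
Qed.

Lemma cvg_complex (R : realType) (T : Type) (F : set_system T) (FF : Filter F)
    (f : T -> R[i]) (z : R[i]) :
  complex.Re (f x) @[x --> F] --> complex.Re z ->
  complex.Im (f x) @[x --> F] --> complex.Im z -> f x @[x --> F] --> z.
Proof.
move=> fRe fIm.
apply: (@cvgrPdist_lt _ (R[i]^o : normedModType R[i]) _ _ FF f z).2 => -[e e'] /=.
(* The radius is an element of [R[i]]; positivity in the partial order of [R[i]] forces its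
   imaginary part to be 0. *)
rewrite ltcE /= => /andP[/eqP -> e0].
have e20 : 0 < e / 2 by rewrite divr_gt0.
near=> x.
have hR : `|complex.Re z - complex.Re (f x)| < e / 2.
  by near: x; exact: ((cvgrPdist_lt _ _).1 fRe).
have hI : `|complex.Im z - complex.Im (f x)| < e / 2.
  by near: x; exact: ((cvgrPdist_lt _ _).1 fIm).
rewrite normE ltcR.
have -> : z - f x = (complex.Re z - complex.Re (f x))%:C +
     'i * (complex.Im z - complex.Im (f x))%:C.
  by case: (z); case: (f x) => a b c d /=; simpc.
apply: le_lt_trans (ler_normcD _ _) _.
rewrite normcM /= !expr0n /= !addr0 add0r expr1n sqrtr1 mul1r !sqrtr_sqr.
by rewrite [e]splitr ltrD.
Unshelve. all: by end_near. Qed.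

Lemma continuous_complex (R : realType) (T : topologicalType) (f : T -> R[i]) :
  continuous f <->
  continuous (@complex.Re R \o f) /\ continuous (@complex.Im R \o f).
Proof.
split=> [cf|[cR cI] x]; last exact: cvg_complex (cR x) (cI x).
split=> x; apply: (continuous_comp (cf x)); [exact: continuous_Re|exact: continuous_Im].
Qed.

(** * The exponential as a continuous character of R/Z *)

Section circle_exponential.
Variable R : realType.

(** The lift of [expi2pi] to the real line, where the identities and limits for sine and cosine
    apply. *)
Definition cexp (r : R) : R[i] := cos (2 * pi * r) +i* sin (2 * pi * r).

Lemma cexpD r s : cexp (r + s) = cexp r * cexp s.
Proof.
rewrite /cexp mulrDr cosD sinD; simpc; congr (_ +i* _).
by rewrite addrC.
Qed.

Lemma cexp0 : cexp 0 = 1.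
Proof. by rewrite /cexp mulr0 cos0 sin0. Qed.

Lemma cexp_nat n : cexp n%:R = 1.
Proof.
elim: n => [|n IH]; first exact: cexp0.
rewrite -addn1 natrD cexpD IH mul1r /cexp mulr1.
by rewrite mulrC mulr_natr cos2pi sin2pi.
Qed.

Lemma cexpN r : cexp (- r) = (cexp r)^-1.
Proof.
have h : cexp (- r) * cexp r = 1 by rewrite -cexpD addNr cexp0.
have nz : cexp r != 0.
  by apply/eqP => e; move/eqP: h; rewrite e mulr0 eq_sym oner_eq0.
by apply: (mulIf nz); rewrite h mulVf.
Qed.

Lemma cexp_int r : r \is a Num.int -> cexp r = 1.
Proof.
case/intrP => [[n|n]] ->; first exact: cexp_nat.
by rewrite NegzE rmorphN /= cexpN cexp_nat invr1.
Qed.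

(** The representative chosen by [repr] differs from [r] by an integer, and [cexp] is 1 at
    integers. *)
Lemma expi2pi_pi (r : R) : expi2pi (\pi_(circle R) r) = cexp r.
Proof.
rewrite -[LHS]/(cexp (repr (\pi_(circle R) r))).
set s := repr _.
have : s - r \in (Num.int_num_subdef : {pred R}).
  rewrite Quotient.idealrBE; apply/eqP.
  exact: (@reprK _ {ideal_quot (Num.int_num_subdef : {pred R})}).
move=> h; rewrite -[s](subrK r) cexpD cexp_int ?mul1r //.
Qed.

Lemma circleE (t : circle R) : t = \pi_(circle R) (repr t).
Proof. by rewrite reprK. Qed.

Lemma pi_circleD (r s : R) :
  \pi_(circle R) (r + s) = \pi_(circle R) r + \pi_(circle R) s.
Proof.
exact: (raddfD (\pi_({ideal_quot (Num.int_num_subdef : {pred R})})) r s).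
Qed.

Lemma expi2piD (s t : circle R) : expi2pi (s + t) = expi2pi s * expi2pi t.
Proof.
by rewrite (circleE s) (circleE t) -pi_circleD !expi2pi_pi cexpD.
Qed.

Lemma expi2pi0 : expi2pi (0 : circle R) = 1.
Proof.
by rewrite -cexp0 -expi2pi_pi; congr expi2pi; symmetry;
   exact: (raddf0 (\pi_({ideal_quot (Num.int_num_subdef : {pred R})}))).
Qed.

Lemma normc_expi2pi (t : circle R) : normc (expi2pi t) = 1.
Proof. by rewrite /= cos2Dsin2 sqrtr1. Qed.

Lemma expi2pi_neq0 (t : circle R) : expi2pi t != 0.
Proof.
apply/eqP => h; move: (normc_expi2pi t); rewrite h normc0 => /eqP.
by rewrite eq_sym oner_eq0.
Qed.

Lemma expi2piN (t : circle R) : expi2pi (- t) = (expi2pi t)^-1.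
Proof.
by apply: (mulIf (expi2pi_neq0 t)); rewrite -expi2piD addNr expi2pi0 mulVf ?expi2pi_neq0.
Qed.

Lemma continuous_cexp : continuous cexp.
Proof.
apply/continuous_complex; split=> r.
  apply: (@continuous_comp _ _ _ (fun r : R => 2 * pi * r) cos).
    exact: mulrl_continuous.
  exact: continuous_cos.
apply: (@continuous_comp _ _ _ (fun r : R => 2 * pi * r) sin).
  exact: mulrl_continuous.
exact: continuous_sin.
Qed.

Lemma continuous_expi2pi : continuous (@expi2pi R).
Proof.
apply/quotient_continuous.
rewrite (_ : _ \o _ = cexp); first exact: continuous_cexp.
by apply/funext => r; exact: expi2pi_pi.
Qed.

End circle_exponential.

(** * Dominated complex series and the Weierstrass M-test *)

Section complex_series.
Variable R : realType.
Implicit Types u v : nat -> R[i].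

(* Componentwise, because [R[i]] is not equipped with a complete structure. *)
Definition csum u : R[i] :=
  limn (series (fun n => complex.Re (u n))) +i*
  limn (series (fun n => complex.Im (u n))).

Definition csummable u := exists M : nat -> R,
  cvgn (series M) /\ forall n, normc (u n) <= M n.

Lemma cvg_series_dominated (a M : nat -> R) :
  cvgn (series M) -> (forall n, `|a n| <= M n) -> cvgn (series a).
Proof.
move=> cM aM; apply: normed_cvg; apply: (series_le_cvg _ _ aM) => //.
by move=> n; apply: le_trans (aM n).
Qed.

Lemma csummable_Re u : csummable u -> cvgn (series (fun n => complex.Re (u n))).
Proof.
move=> [M [cM uM]]; apply: (cvg_series_dominated cM) => n.
exact: le_trans (ler_Re_normc _) (uM n).
Qed.

Lemma csummable_Im u : csummable u -> cvgn (series (fun n => complex.Im (u n))).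
Proof.
move=> [M [cM uM]]; apply: (cvg_series_dominated cM) => n.
exact: le_trans (ler_Im_normc _) (uM n).
Qed.

Lemma csumD u v : csummable u -> csummable v ->
  csum (fun n => u n + v n) = csum u + csum v.
Proof.
move=> su sv; rewrite /csum /=; simpc; congr (_ +i* _).
- rewrite -lim_seriesD; [|exact: csummable_Re|exact: csummable_Re].
  by congr (limn (series _)); apply/funext => n; rewrite ReD.
- rewrite -lim_seriesD; [|exact: csummable_Im|exact: csummable_Im].
  by congr (limn (series _)); apply/funext => n; rewrite ImD.
Qed.

Lemma csumZ (a : R[i]) u : csummable u -> csum (fun n => a * u n) = a * csum u.
Proof.
case: a => a b su; have cR := csummable_Re su; have cI := csummable_Im su.
have zR k := lim_seriesZ k cR; have zI k := lim_seriesZ k cI.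
rewrite /csum /=; simpc; congr (_ +i* _).
- rewrite -[a * _]zR -[b * _]zI -lim_seriesB; try exact: is_cvg_seriesZ.
  by congr (limn (series _)); apply/funext => n; rewrite !fctE /=; case: (u n).
- rewrite -[a * _]zI -[b * _]zR -lim_seriesD; try exact: is_cvg_seriesZ.
  by congr (limn (series _)); apply/funext => n; rewrite !fctE /=; case: (u n).
Qed.

Lemma csum_single u N : (forall n, n != N -> u n = 0) -> csum u = u N.
Proof.
move=> u0; have key (f : R[i] -> R) : f 0 = 0 ->
    limn (series (fun n => f (u n))) = f (u N).
  move=> f0; apply: cvg_lim => //; apply: cvg_near_cst; near=> n.
  rewrite seriesEnat /= (bigD1_seq N) ?iota_uniq //=; last first.
    by rewrite mem_index_iota /=; near: n; exact: nbhs_infty_gt.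
  by rewrite big1 ?addr0// => i iN; rewrite u0.
by rewrite /csum !key //; case: (u N).
Unshelve. all: by end_near. Qed.

(** Finite blocks of the two series are compared and the limit is taken. The bound does not involve
    [a], so it is uniform when [a] depends on a parameter. *)
Lemma weierstrass_dist (a M : nat -> R) (N : nat) :
  cvgn (series M) -> (forall n, `|a n| <= M n) ->
  `|limn (series a) - series a N| <= limn (series M) - series M N.
Proof.
move=> cM aM; have ca := cvg_series_dominated cM aM.
have h1 : `|series a n - series a N| @[n --> \oo] --> `|limn (series a) - series a N|.
  by apply: cvg_norm; apply: cvgB => //; exact: cvg_cst.
have h2 : series M n - series M N @[n --> \oo] --> limn (series M) - series M N.
  by apply: cvgB => //; exact: cvg_cst.
apply: (ler_cvg_to h1 h2); near=> n.
have Nn : (N <= n)%N by near: n; exact: nbhs_infty_ge.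
rewrite !sub_series_geq //; apply: le_trans (ler_norm_sum _ _ _) _.
exact: ler_sum.
Unshelve. all: by end_near. Qed.

(** The e/3 argument: the truncation index [N] is chosen from the majorant alone, hence serves all
    points at once, and the truncated series is a finite sum of continuous functions. *)
Lemma continuous_weierstrass (T : topologicalType) (f : T -> nat -> R) (M : nat -> R) :
  cvgn (series M) -> (forall x n, `|f x n| <= M n) ->
  (forall n, continuous (f^~ n)) -> continuous (fun x => limn (series (f x))).
Proof.
move=> cM fM cf x; apply: (@cvgrPdist_lt _ _ _ _ (nbhs_filter x) _ _).2 => e e0.
have e3 : 0 < e / 3 by rewrite divr_gt0.
have [N _ hN] := (cvgrPdist_lt _ _).1 cM _ e3.
have {}hN : limn (series M) - series M N < e / 3.
  by apply: le_lt_trans (hN N (leqnn _)); exact: ler_norm.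
have cN : continuous (fun y => series (f y) N).
  elim: (N) => [|n IH] y.
    by under eq_fun do rewrite seriesEnat /= big_geq //; exact: cvg_cst.
  by under eq_fun do rewrite seriesSr; apply: cvgD; [exact: IH|exact: cf].
have := (@cvgrPdist_lt _ _ _ _ (nbhs_filter x) _ _).1 (cN x) _ e3.
apply: filterS => y hy.
have hx' := weierstrass_dist N cM (fM x).
have hy' := weierstrass_dist N cM (fM y).
have -> : limn (series (f x)) - limn (series (f y)) =
  (limn (series (f x)) - series (f x) N) + (series (f x) N - series (f y) N)
  - (limn (series (f y)) - series (f y) N) by lra.
apply: le_lt_trans (ler_normB _ _) _.
apply: le_lt_trans (lerD (ler_normD _ _) (lexx _)) _; lra.
Qed.

End complex_series.

(** * Series of products in separate variables, and their partial derivatives *)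

Section smooth_functions.
Variable R : realType.
Implicit Types (c d : pred nat) (x : torus R) (j n : nat).
Implicit Types (f : torus R -> R[i]) (g : nat -> circle R -> R[i]).

(** Boundedness travels with continuity because it provides the majorants and, later, integrability
    against a probability measure. *)
Definition bounded_continuous (T : topologicalType) (f : T -> R[i]) :=
  continuous f /\ exists M : R, forall y, normc (f y) <= M.

Definition indep j f := forall x h, f (shift_coord j x h) = f x.

(** The bound 9/10 concerns all but finitely many factors, so that the condition survives replacing
    one factor by its derivative. *)
Definition admissible g := (forall j, continuous (g j)) /\
  exists B : nat -> R, (forall j t, normc (g j t) <= B j) /\
    \forall j \near \oo, B j <= 9 / 10.

Definition subst g j (h : circle R -> R[i]) : nat -> circle R -> R[i] :=
  fun i => if i == j then h else g i.

(** The predicate [c] selects the lengths that are kept: differentiating in x_j discards the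
    products of length at most j, and the result must again have this form. *)
Definition term c g x n : R[i] := (c n)%:R * \prod_(i < n) g i (x i).

Definition prod_series c g x : R[i] := csum (term c g x).

Lemma admissible_subst g j h : bounded_continuous h -> admissible g ->
  admissible (subst g j h).
Proof.
move=> [ch [M hM]] [cg [B [gB B9]]]; split.
  by move=> i; rewrite /subst; case: eqP => _; [exact: ch|exact: cg].
exists (fun i => if i == j then M else B i); split.
  by move=> i t; rewrite /subst; case: eqP.
near=> i; rewrite ifN; first by near: i.
by rewrite gtn_eqF //; near: i; exact: nbhs_infty_gt.
Unshelve. all: by end_near. Qed.

(** Finitely many factors exceeding 9/10 cost only a constant [K], so a geometric majorant of ratio
    9/10 remains, uniform in [c] and [x]. *)
Lemma admissible_bound g : admissible g -> exists M : nat -> R,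
  cvgn (series M) /\ forall c x n, normc (term c g x n) <= M n.
Proof.
move=> [_ [B [gB [J _ hJ]]]].
(* [e j] is the excess of [B j] over 9/10, raised to at least 1; it equals 1 from [J] on. *)
pose e j : R := if (j < J)%N then Num.max 1 (B j / (9 / 10)) else 1.
have e1 j : 1 <= e j by rewrite /e; case: ifP => //; rewrite le_max lexx.
pose K := \prod_(j < J) e j.
have Be j : B j <= 9 / 10 * e j.
  rewrite /e; case: ltnP => jJ; last by rewrite mulr1; exact: hJ.
  rewrite mulrC -ler_pdivrMr; last by lra.
  by rewrite le_max lexx orbT.
have eK n : \prod_(j < n) e j <= K.
  (* Both products are compared with the one over [n + J] indices: factors past [J] are 1, and
     factors past [n] are at least 1. *)
  have -> : K = \prod_(0 <= j < n + J) e j.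
    rewrite (@big_cat_nat _ _ _ J) ?leq_addl //= big_mkord -[LHS]mulr1; congr (_ * _).
    rewrite big_nat_cond big1 // => i /andP[/andP[Ji _] _].
    by rewrite /e ltnNge Ji.
  rewrite (@big_cat_nat _ _ _ n) ?leq_addr //= big_mkord ler_peMr //.
    by apply: prodr_ge0 => i _; exact: le_trans (e1 i).
  elim/big_ind: _ => // a b a1 b1; rewrite -[1]mulr1; exact: ler_pM.
exists (geometric K (9 / 10)); split.
  apply: is_cvg_geometric_series; rewrite ger0_norm; lra.
move=> c x n; rewrite /term normcM normc_prod /=.
have := eK n; set P := \prod_(i < n) e i => PK.
have hP : \prod_(i < n) normc (g i (x i)) <= (9 / 10) ^+ n * P.
  have -> : (9 / 10) ^+ n * P = \prod_(i < n) (9 / 10 * e i).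
    by rewrite big_split /= prodr_const card_ord.
  apply: ler_prod => i _; rewrite normc_ge0 /=; exact: le_trans (gB _ _) (Be _).
apply: (@le_trans _ _ (\prod_(i < n) normc (g i (x i)))).
  apply: ler_piMl; first by apply: prodr_ge0 => i _; exact: normc_ge0.
  by case: (c n); rewrite ?normc0 ?normc1.
apply: le_trans hP _; rewrite mulrC ler_wpM2r // exprn_ge0 //; lra.
Qed.

Lemma csummable_term c g x : admissible g -> csummable (term c g x).
Proof. by move=> /admissible_bound[M [cM hM]]; exists M. Qed.

Lemma continuous_coord j : continuous (fun x : torus R => x j).
Proof. exact: (@proj_continuous nat (fun=> circle R) j). Qed.

Lemma bounded_continuousM (T : topologicalType) (f g : T -> R[i]) :
  bounded_continuous f -> bounded_continuous g ->
  bounded_continuous (fun y => f y * g y).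
Proof.
move=> [cf [M fM]] [cg [N gN]]; split.
  by move=> y; exact: (@cvgM _ _ (nbhs y) (nbhs_filter y) _ _ _ _ (cf y) (cg y)).
by exists (M * N) => x; rewrite normcM ler_pM ?normc_ge0.
Qed.

Lemma bounded_continuousD (T : topologicalType) (f g : T -> R[i]) :
  bounded_continuous f -> bounded_continuous g ->
  bounded_continuous (fun y => f y + g y).
Proof.
move=> [cf [M fM]] [cg [N gN]]; split.
  by move=> y; exact: (@cvgD _ R[i]^o _ (nbhs y) (nbhs_filter y) _ _ _ _ (cf y) (cg y)).
by exists (M + N) => x; apply: le_trans (ler_normcD _ _) _; rewrite lerD.
Qed.

Lemma bounded_continuous_cst (T : topologicalType) (a : R[i]) :
  bounded_continuous (fun _ : T => a).
Proof. by split; [move=> x; exact: cvg_cst|exists (normc a)]. Qed.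

Lemma bounded_continuous_prod (T : topologicalType) (F : nat -> T -> R[i]) n :
  (forall i, bounded_continuous (F i)) ->
  bounded_continuous (fun y => \prod_(i < n) F i y).
Proof.
move=> hF; elim: n => [|n IH].
  rewrite (_ : (fun y => _) = fun=> 1); first exact: bounded_continuous_cst.
  by apply/funext => x; rewrite big_ord0.
rewrite (_ : (fun y => _) = fun y => \prod_(i < n) F i y * F n y).
  exact: bounded_continuousM.
by apply/funext => x; rewrite big_ord_recr.
Qed.

Lemma bounded_continuous_coord j (u : circle R -> R[i]) :
  bounded_continuous u -> bounded_continuous (fun x : torus R => u (x j)).
Proof.
move=> [cu [M uM]]; split; last by exists M => x.
move=> x; apply: (@continuous_comp _ _ _ (fun x : torus R => x j) u).
  exact: continuous_coord.
exact: cu.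
Qed.

Lemma prod_series_bounded_continuous c g : admissible g ->
  bounded_continuous (prod_series c g).
Proof.
move=> ag; have [M [cM hM]] := admissible_bound ag.
have cterm n : continuous (fun x => term c g x n).
  have gi i : bounded_continuous (fun x : torus R => g i (x i)).
    apply: bounded_continuous_coord; case: ag => cg [B [gB _]].
    by split; [exact: cg|exists (B i)].
  by have [] := bounded_continuousM (bounded_continuous_cst _ (c n)%:R)
    (bounded_continuous_prod n gi).
have hR x n : `|complex.Re (term c g x n)| <= M n.
  exact: le_trans (ler_Re_normc _) (hM _ _ _).
have hI x n : `|complex.Im (term c g x n)| <= M n.
  exact: le_trans (ler_Im_normc _) (hM _ _ _).
split.
  apply/continuous_complex; split.
    apply: (continuous_weierstrass cM hR) => n.
    by have [+ _] := (continuous_complex _).1 (cterm n).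
  apply: (continuous_weierstrass cM hI) => n.
  by have [_ +] := (continuous_complex _).1 (cterm n).
exists (limn (series M) + limn (series M)) => x.
(* With the empty partial sum, the tail estimate bounds the whole sum. *)
have S0 (u : nat -> R) : series u 0%N = 0 by rewrite /series /= big_geq.
have := weierstrass_dist 0 cM (hR x); have := weierstrass_dist 0 cM (hI x).
rewrite !S0 !subr0 => bI bR.
rewrite [X in normc X](complexE (prod_series c g x)).
apply: le_trans (ler_normcD _ _) _; rewrite normcM /=.
by rewrite !expr0n /= !addr0 add0r expr1n sqrtr1 mul1r !sqrtr_sqr lerD.
Qed.

Lemma prod_seriesID c d g x : admissible g ->
  prod_series c g x = prod_series [pred n | c n & d n] g x +
                      prod_series [pred n | c n & ~~ d n] g x.
Proof.
move=> ag; rewrite /prod_series -csumD; try exact: csummable_term.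
congr csum; apply/funext => n; rewrite /term /= -mulrDl; congr (_ * _).
by case: (c n); case: (d n); rewrite /= ?addr0 ?add0r.
Qed.

(** Every kept product is longer than [j], so it contains the factor of index [j] exactly once and
    that factor comes out of the series. *)
Lemma prod_series_factor c g j h x : admissible g ->
  (forall n, c n -> (j < n)%N) ->
  prod_series c (subst g j h) x = h (x j) * prod_series c (subst g j (fun=> 1)) x.
Proof.
move=> ag cj; rewrite /prod_series -csumZ; last first.
  by apply: csummable_term; apply: admissible_subst => //; exact: bounded_continuous_cst.
congr csum; apply/funext => n; rewrite /term.
have [cn|] := boolP (c n); last by rewrite !mul0r mulr0.
rewrite !mul1r (bigD1 (Ordinal (cj n cn))) //= [in RHS](bigD1 (Ordinal (cj n cn))) //=.
rewrite /subst eqxx mul1r; congr (_ * _); apply: eq_bigr => i ij.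
by rewrite !ifN.
Qed.

Lemma shift_coordE j x h i :
  shift_coord j x h i = if i == j then x j + \pi_(circle R) h else x i.
Proof.
rewrite /shift_coord; case: eqP => [->|/eqP ij]; first by rewrite dfwithin.
by rewrite dfwithout // eq_sym.
Qed.

(** A product of length at most [j] involves only variables of index less than [j]. *)
Lemma indep_prod_series_le c g j : (forall n, c n -> (n <= j)%N) ->
  indep j (prod_series c g).
Proof.
move=> cj x h; congr csum; apply/funext => n; rewrite /term.
have [cn|] := boolP (c n); last by rewrite !mul0r.
congr (_ * _); apply: eq_bigr => i _; rewrite shift_coordE ifN //.
by rewrite neq_ltn (leq_trans (ltn_ord i)) // cj.
Qed.

Lemma indep_prod_series_subst c g j (a : R[i]) :
  indep j (prod_series c (subst g j (fun=> a))).
Proof.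
move=> x h; congr csum; apply/funext => n; rewrite /term; congr (_ * _).
by apply: eq_bigr => i _; rewrite /subst shift_coordE; case: eqP.
Qed.

Lemma subst_id g j : subst g j (g j) = g.
Proof. by apply/funext => i; rewrite /subst; case: eqP => [->|]. Qed.

(** Both series on the right are independent of x_j, so the dependence on x_j is affine in
    [g j (x j)]. Differentiation of the series thus reduces to one factor, with no interchange of
    limits. *)
Lemma prod_series_split c g j x : admissible g ->
  prod_series c g x = prod_series [pred n | c n & (n <= j)%N] g x +
    g j (x j) * prod_series [pred n | c n & ~~ (n <= j)%N] (subst g j (fun=> 1)) x.
Proof.
move=> ag; rewrite (prod_seriesID c (fun n => n <= j)%N) //; congr (_ + _).
rewrite -{1}(subst_id g j) prod_series_factor // => n /andP[_].
by rewrite -ltnNge.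
Qed.

(** Derivative on R/Z, with real increments projected to the circle as in [diff_quot]. *)
Definition circle_derive (u v : circle R -> R[i]) := forall t,
  (h^-1)%:C * (u (t + \pi_(circle R) h) - u t) @[h --> (0 : R)^'] --> v t.

Lemma diff_quot_prod_series c g j v x : admissible g -> circle_derive (g j) v ->
  diff_quot j (prod_series c g) x h @[h --> (0 : R)^'] -->
  prod_series [pred n | c n & ~~ (n <= j)%N] (subst g j v) x.
Proof.
move=> ag gv; rewrite prod_series_factor //; last first.
  by move=> n /andP[_]; rewrite -ltnNge.
set B := prod_series _ (subst g j (fun=> 1)) x.
(* The short products cancel in the difference and [B] is unchanged by the shift; what remains is
   the difference quotient of [g j] times [B]. *)
rewrite (_ : (fun h => _) = fun h =>
  ((h^-1)%:C * (g j (x j + \pi_(circle R) h) - g j (x j))) * B); last first.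
  apply/funext => h; rewrite /diff_quot (prod_series_split c j x ag).
  rewrite (prod_series_split c j (shift_coord j x h) ag).
  have -> := @indep_prod_series_le [pred n | c n & (n <= j)%N] g j _ x h.
    have -> : prod_series [pred n | c n & ~~ (n <= j)%N] (subst g j (fun=> 1))
        (shift_coord j x h) = B by exact: indep_prod_series_subst.
    rewrite shift_coordE eqxx -/B; set A := prod_series _ _ _.
    set b := g j _; set d := g j _; ring.
  by move=> n /andP[].
exact: (cvgM (gv (x j)) (cvg_cst B)).
Qed.

Lemma has_partial_prod_series c g j v : admissible g -> circle_derive (g j) v ->
  has_partial j (prod_series c g).
Proof.
move=> ag gv x; exact: cvgP (diff_quot_prod_series (c := c) (x := x) ag gv).
Qed.

Lemma partial_prod_series c g j v : admissible g -> circle_derive (g j) v ->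
  partial j (prod_series c g) = prod_series [pred n | c n & ~~ (n <= j)%N] (subst g j v).
Proof.
move=> ag gv; apply/funext => x; apply: cvg_lim; last exact: diff_quot_prod_series.
exact: (@norm_hausdorff _ R[i]^o).
Qed.

End smooth_functions.

(** * The trigonometric polynomial, the example and its smoothness *)

Section example.
Variable R : realType.

Lemma cexpX (r : R) n : cexp r ^+ n = cexp (n%:R * r).
Proof.
elim: n => [|n IH]; first by rewrite mul0r cexp0 expr0.
by rewrite exprS IH -cexpD -[n.+1]add1n natrD mulrDl mul1r.
Qed.

Lemma cexp_half : cexp (2^-1 : R) = -1.
Proof.
rewrite /cexp mulrAC mulfV ?pnatr_eq0 // mul1r cospi sinpi.
by apply/eqP; rewrite eq_complex /= oppr0 !eqxx.
Qed.
Lemma cexp_diff_quot (a : R) :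
  (h^-1)%:C * (cexp (a * h) - 1) @[h --> (0 : R)^'] --> 'i * (2 * pi * a)%:C.
Proof.
have dlin : is_derive (0 : R) (1 : R) ( *%R (2 * pi * a)) (2 * pi * a).
  have := @is_deriveZ R R R id (2 * pi * a) 0 1 1 (is_derive_id _ _).
  by rewrite /GRing.scale /= mulr1.
(* The derivative at 0 restated as a limit of difference quotients, for use on the sine and cosine
   parts after the chain rule. *)
have q (f : R -> R) (l : R) : is_derive (0 : R) (1 : R) f l ->
    h^-1 * (f h - f 0) @[h --> (0 : R)^'] --> l.
  move=> [df <-]; rewrite /derive.
  have := df; rewrite /derivable; under eq_fun do rewrite /= addr0 /GRing.scale /= mulr1.
  by move=> h; apply: cvg_trans h.
have qs := q _ _ (is_derive1_comp (is_derive_sin _) dlin).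
have qc := q _ _ (is_derive1_comp (is_derive_cos _) dlin).
apply: cvg_complex.
  rewrite [X in _ --> X](_ : _ = - sin (2 * pi * a * 0) * (2 * pi * a)); last first.
    by rewrite /= !mulr0 sin0 oppr0 !mul0r ?mulr0 ?oppr0 addr0.
  rewrite (_ : (fun h => _) = fun h => h^-1 * ((cos \o *%R (2 * pi * a)) h -
    (cos \o *%R (2 * pi * a)) 0)); first exact: qc.
  apply/funext => h /=.
  by rewrite !mulr0 cos0 !mulrA ?mul0r ?mulr0 ?oppr0 ?addr0 ?subr0.
rewrite [X in _ --> X](_ : _ = cos (2 * pi * a * 0) * (2 * pi * a)); last first.
  by rewrite /= !mulr0 cos0 add0r.
rewrite (_ : (fun h => _) = fun h => h^-1 * ((sin \o *%R (2 * pi * a)) h -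
  (sin \o *%R (2 * pi * a)) 0)); first exact: qs.
apply/funext => h /=.
by rewrite !mulr0 sin0 !mulrA ?mul0r !oppr0 !addr0.
Qed.
Implicit Types (u v : circle R -> R[i]).

Lemma circle_deriveZ (a : R[i]) u v : circle_derive u v ->
  circle_derive (fun t => a * u t) (fun t => a * v t).
Proof.
move=> uv t; rewrite (_ : (fun h => _) = fun h =>
  a * ((h^-1)%:C * (u (t + \pi_(circle R) h) - u t))); last first.
  by apply/funext => h; rewrite -mulrBr mulrCA.
exact: (cvgM (cvg_cst a) (uv t)).
Qed.

Lemma circle_derive_sum n (u v : 'I_n -> circle R -> R[i]) :
  (forall k, circle_derive (u k) (v k)) ->
  circle_derive (fun t => \sum_k u k t) (fun t => \sum_k v k t).
Proof.
elim: n u v => [|n IH] u v uv t.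
  rewrite [X in _ --> X]big_ord0; under eq_fun do rewrite !big_ord0 subrr mulr0.
  exact: cvg_cst.
rewrite [X in _ --> X]big_ord_recl (_ : (fun h => _) = fun h =>
  (h^-1)%:C * (u ord0 (t + \pi_(circle R) h) - u ord0 t) +
  (h^-1)%:C * (\sum_(k < n) u (lift ord0 k) (t + \pi_(circle R) h) -
               \sum_(k < n) u (lift ord0 k) t)); last first.
  by apply/funext => h; rewrite !big_ord_recl -mulrDr opprD addrACA.
apply: (@cvgD _ R[i]^o); first exact: uv.
exact: (IH (fun k => u (lift ord0 k)) (fun k => v (lift ord0 k)) (fun k => uv _)).
Qed.

(** Multiplicativity of the exponential reduces the derivative at [t] to the derivative at 0. *)
Lemma circle_derive_monomial n :
  circle_derive (fun t : circle R => expi2pi t ^+ n)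
                (fun t => 'i * (2 * pi * n%:R)%:C * expi2pi t ^+ n).
Proof.
move=> t; rewrite (_ : (fun h => _) = fun h =>
  ((h^-1)%:C * (cexp (n%:R * h) - 1)) * expi2pi t ^+ n); last first.
  apply/funext => h; rewrite expi2piD expi2pi_pi exprMn (cexpX h).
  by rewrite -mulrA mulrBl mul1r [_ ^+ n * cexp _]mulrC.
exact: (cvgM (@cexp_diff_quot n%:R) (cvg_cst (expi2pi t ^+ n))).
Qed.

(** Index [k] belongs to z^(k+1). The factor i on z^2 lowers the maximum of |z + i z^2 + z^3| on the
    circle from 3 to sqrt 5 while all coefficients keep modulus 2/5: the sup norm is below 1, yet
    the moduli add up to 6/5. *)
Definition coef (k : 'I_3) : R[i] := (2 / 5)%:C * 'i ^+ (k == 1%N :> nat).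

(* [trig m] is the [m]-th derivative of [2/5 (z + i z^2 + z^3)], [z = e^(2 pi i t)]. *)
Definition trig m (t : circle R) : R[i] :=
  \sum_(k < 3) coef k * ('i * (2 * pi * k.+1%:R)%:C) ^+ m * expi2pi t ^+ k.+1.

Lemma circle_derive_trig m : circle_derive (trig m) (trig m.+1).
Proof.
rewrite (_ : trig m.+1 = fun t => \sum_(k < 3) coef k *
  ('i * (2 * pi * k.+1%:R)%:C) ^+ m * ('i * (2 * pi * k.+1%:R)%:C * expi2pi t ^+ k.+1)).
  apply: circle_derive_sum => k; apply: circle_deriveZ.
  exact: circle_derive_monomial.
apply/funext => t; apply: eq_bigr => k _; rewrite exprSr !mulrA; ring.
Qed.

Lemma bounded_continuous_expi2pi : bounded_continuous (@expi2pi R).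
Proof.
by split; [exact: continuous_expi2pi|exists 1 => t; rewrite normc_expi2pi].
Qed.

Lemma bounded_continuousX (T : topologicalType) (f : T -> R[i]) n :
  bounded_continuous f -> bounded_continuous (fun y => f y ^+ n).
Proof.
move=> hf; have := bounded_continuous_prod n (fun=> hf).
by congr bounded_continuous; apply/funext => y; rewrite prodr_const card_ord.
Qed.

Lemma bounded_continuous_sum (T : topologicalType) n (F : 'I_n -> T -> R[i]) :
  (forall i, bounded_continuous (F i)) ->
  bounded_continuous (fun y => \sum_i F i y).
Proof.
elim: n F => [|n IH] F hF.
  rewrite (_ : (fun y => _) = fun=> 0); first exact: bounded_continuous_cst.
  by apply/funext => y; rewrite big_ord0.
rewrite (_ : (fun y => _) = fun y => F ord0 y + \sum_(i < n) F (lift ord0 i) y).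
  apply: bounded_continuousD; first exact: hF.
  by apply: IH => i; exact: hF.
by apply/funext => y; rewrite big_ord_recl.
Qed.

Lemma bounded_continuous_trig m : bounded_continuous (trig m).
Proof.
apply: bounded_continuous_sum => k; apply: bounded_continuousM.
  exact: bounded_continuous_cst.
exact: bounded_continuousX bounded_continuous_expi2pi.
Qed.

(* If [z = e^(i s)], then [z + i z^2 + z^3 = z^2 (2 cos s + i)]. *)
Lemma normc_trig0 (t : circle R) : normc (trig 0 t) <= 9 / 10.
Proof.
have -> : trig 0 t =
    (2 / 5)%:C * (expi2pi t + 'i * expi2pi t ^+ 2 + expi2pi t ^+ 3).
  rewrite /trig !big_ord_recl big_ord0 /coef !expr0 !mulr1 addr0.
  rewrite -[LHS]/((2 / 5)%:C * expi2pi t + ((2 / 5)%:C * 'i * expi2pi t ^+ 2 +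
    (2 / 5)%:C * expi2pi t ^+ 3)).
  by rewrite !mulrDr !mulrA !addrA.
have := cos2Dsin2 (2 * pi * repr t); rewrite /expi2pi.
move: (cos _) (sin _) => c s cs.
set z := c +i* s.
have nz : normc z = 1 by rewrite /= cs sqrtr1.
have zz : z * (c -i* s) = 1.
  by rewrite /z; simpc; rewrite -!expr2 cs; congr (_ +i* _); ring.
have e : (2 * c) +i* 1 = z + (c -i* s) + 'i by rewrite /z; simpc; congr (_ +i* _); ring.
have -> : z + 'i * z ^+ 2 + z ^+ 3 = z ^+ 2 * ((2 * c) +i* 1).
  transitivity (z * (z * (c -i* s)) + 'i * z ^+ 2 + z ^+ 3); first by rewrite zz mulr1.
  by rewrite e; ring.
rewrite 2!normcM normcX nz expr1n mul1r /= expr0n /= addr0 expr1n sqrtr_sqr.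
rewrite ger0_norm; last lra.
(* From c^2 <= 1, 4 c^2 + 1 <= 5 <= (9/4)^2; multiplying by 2/5 gives 9/10. *)
have : Num.sqrt ((2 * c) ^+ 2 + 1) <= 9 / 4.
  rewrite -[9 / 4]ger0_norm; last by apply: divr_ge0.
  by rewrite -sqrtr_sqr ler_wsqrtr //; nra.
lra.
Qed.

Definition trig_admissible (g : nat -> circle R -> R[i]) :=
  admissible g /\ forall j, exists m, g j = trig m.

Lemma trig_admissible0 : trig_admissible (fun=> trig 0).
Proof.
split; last by move=> j; exists 0%N.
split; first by move=> j; have [] := bounded_continuous_trig 0.
exists (fun=> 9 / 10); split; first by move=> j; exact: normc_trig0.
exact: nearW.
Qed.

Definition example : torus R -> R[i] := prod_series predT (fun=> trig 0).

(** Existence and shape are proved together by induction on [s]: the explicit form of one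
    derivative, with every factor some [trig m], is what makes the next one exist. *)
Lemma partials_example s : has_partials s example /\
  exists c g, trig_admissible g /\ partials s example = prod_series c g.
Proof.
elim: s => [|j s [hs [c [g [[ag gt] es]]]]] /=.
  by split=> //; exists predT, (fun=> trig 0); split=> //; exact: trig_admissible0.
have [m gm] := gt j.
have gv : circle_derive (g j) (trig m.+1) by rewrite gm; exact: circle_derive_trig.
split; first by split=> //; rewrite es; exact: has_partial_prod_series ag gv.
exists [pred n | c n & ~~ (n <= j)%N], (subst g j (trig m.+1)); split.
  split; first exact: admissible_subst (bounded_continuous_trig _) ag.
  by move=> i; rewrite /subst; case: eqP => _; [exists m.+1|exact: gt].
by rewrite es; exact: partial_prod_series.
Qed.

Lemma classCinfty_example : classCinfty example.
Proof.
move=> k alpha _; have [hs [c [g [[ag _] es]]]] := partials_example (directions alpha).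
by split=> //; rewrite es; have [] := prod_series_bounded_continuous c ag.
Qed.

End example.

(** * Complex integrals on the torus and translation invariance *)

Section integration.
Variables (R : realType) (mu : probability (borel_torus R) R).
Implicit Types (f K : torus R -> R[i]).

Lemma measurable_continuous_torus (f : torus R -> R) :
  continuous f -> measurable_fun setT (f : borel_torus R -> R).
Proof.
move=> cf; apply: (measurability _ (RGenOpens.measurableE R)).
move=> _ [_ [a [b ->] <-]]; rewrite setTI; apply: sub_sigma_algebra.
by move/continuousP: cf; apply; exact: interval_open.
Qed.

Lemma integrable_bounded_continuous (f : torus R -> R) :
  continuous f -> (exists M, forall x, `|f x| <= M) ->
  mu.-integrable setT (EFin \o (f : borel_torus R -> R)).
Proof.
move=> cf [M fM]; apply: measurable_bounded_integrable => //.
- by apply: (le_lt_trans (probability_le1 mu measurableT)); rewrite ltry.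
- exact: measurable_continuous_torus.
- exists M; split; first exact: num_real.
  by move=> N MN x _; apply: le_trans (fM x) (ltW MN).
Qed.

Lemma integrable_Re f : bounded_continuous f ->
  mu.-integrable setT (EFin \o ((fun x => complex.Re (f x)) : borel_torus R -> R)).
Proof.
move=> [cf [M fM]]; apply: integrable_bounded_continuous.
  by have [] := (continuous_complex f).1 cf.
by exists M => x; apply: le_trans (ler_Re_normc _) (fM x).
Qed.

Lemma integrable_Im f : bounded_continuous f ->
  mu.-integrable setT (EFin \o ((fun x => complex.Im (f x)) : borel_torus R -> R)).
Proof.
move=> [cf [M fM]]; apply: integrable_bounded_continuous.
  by have [] := (continuous_complex f).1 cf.
by exists M => x; apply: le_trans (ler_Im_normc _) (fM x).
Qed.

Lemma cintegralD f K : bounded_continuous f -> bounded_continuous K ->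
  cintegral mu (fun x => f x + K x) = cintegral mu f + cintegral mu K.
Proof.
move=> hf hK; rewrite /cintegral; simpc; congr (_ +i* _).
- rewrite -RintegralD //; [|exact: integrable_Re|exact: integrable_Re].
  by apply: eq_Rintegral => x _; rewrite ReD.
- rewrite -RintegralD //; [|exact: integrable_Im|exact: integrable_Im].
  by apply: eq_Rintegral => x _; rewrite ImD.
Qed.

Lemma cintegralZ (a : R[i]) f : bounded_continuous f ->
  cintegral mu (fun x => a * f x) = a * cintegral mu f.
Proof.
case: a => a b hf; have iR := integrable_Re hf; have iI := integrable_Im hf.
have mulint (r : R) (u : borel_torus R -> R) : mu.-integrable setT (EFin \o u) ->
    mu.-integrable setT (EFin \o (fun x => r * u x)).
  by move=> iu; have := integrableZl measurableT r iu; congr (_.-integrable _ _).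
rewrite /cintegral; simpc; congr (_ +i* _).
- rewrite -!RintegralZl // -RintegralB //; try exact: mulint.
  by apply: eq_Rintegral => x _; case: (f x).
- rewrite -!RintegralZl // -RintegralD //; try exact: mulint.
  by apply: eq_Rintegral => x _; case: (f x).
Qed.

Lemma cintegral1 : cintegral mu (fun=> 1) = 1.
Proof.
rewrite /cintegral /= !Rintegral_cst // mul0r mul1r.
transitivity (fine (1%E : \bar R) +i* 0); last by [].
congr (fine _ +i* _); exact: (@probability_setT _ _ _ mu).
Qed.

Lemma cintegral_sum n (F : 'I_n -> torus R -> R[i]) :
  (forall i, bounded_continuous (F i)) ->
  cintegral mu (fun x => \sum_i F i x) = \sum_i cintegral mu (F i).
Proof.
elim: n F => [|n IH] F hF.
  rewrite big_ord0 (_ : (fun x => _) = fun=> 0 * 1); last first.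
    by apply/funext => x; rewrite big_ord0 mul0r.
  by rewrite cintegralZ ?mul0r //; exact: bounded_continuous_cst.
rewrite big_ord_recl -IH => [|i]; last exact: hF.
rewrite -cintegralD; [|exact: hF|by apply: bounded_continuous_sum => i; exact: hF].
by congr cintegral; apply/funext => x; rewrite big_ord_recl.
Qed.

Lemma continuous_circleD (a : circle R) : continuous (fun t : circle R => t + a).
Proof.
apply/quotient_continuous.
have -> : (fun t : circle R => t + a) \o \pi_(circle R) =
    \pi_(circle R) \o (fun r : R => r + repr a).
  by apply/funext => r /=; rewrite pi_circleD -circleE.
move=> r; apply: continuous_comp; last exact: pi_continuous.
by apply: cvgD; [exact: cvg_id|exact: cvg_cst].
Qed.

Lemma continuous_translate (a : torus R) : continuous (translate a).
Proof.
have ci i : continuous (fun x : torus R => x i + a i).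
  move=> x; exact: (@continuous_comp (torus R) (circle R) (circle R) (fun x => x i)
    (fun t => t + a i) x (@continuous_coord R i x) (@continuous_circleD (a i) (x i))).
(* The product topology is the supremum of the topologies induced by the coordinates, so continuity
   is checked on each coordinate. *)
move=> x; apply/cvg_sup; first exact/fmap_filter/nbhs_filter.
move=> i; move: x.
exact: (@continuous_comp_initial _ _ _ (fun f : torus R => f i) _ (ci i)).
Qed.

Hypothesis mu_haar : is_haar mu.

(** The pushforward of [mu] under the translation agrees with [mu] on Borel sets, so the change of
    variables formula carries invariance from sets to integrals. *)
Lemma Rintegral_translate (a : torus R) (f : torus R -> R) :
  continuous f -> (exists M, forall x, `|f x| <= M) ->
  \int[mu]_(x in setT) (f (translate a x)) = \int[mu]_(x in setT) f x.
Proof.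
move=> cf bf; have mt : measurable_fun setT (translate a : borel_torus R -> borel_torus R).
  apply: (@measurability _ _ (borel_torus R) (borel_torus R) setT (translate a)
    (@open (torus R)) erefl).
  move=> _ [U oU <-]; rewrite setTI; apply: sub_sigma_algebra.
  by move/continuousP: (@continuous_translate a); exact.
have mf := measurable_continuous_torus cf.
have cft : continuous (fun x => f (translate a x)).
  by move=> x; apply: continuous_comp; [exact: continuous_translate|exact: cf].
have ift : mu.-integrable setT (EFin \o (fun x : borel_torus R => f (translate a x))).
  by apply: integrable_bounded_continuous => //; case: bf => M fM; exists M.
rewrite /Rintegral; congr fine.
have := @integral_pushforward _ _ _ _ R _ mt mu setT (EFin \o f).
rewrite preimage_setT => /(_ _ ift measurableT) <-; last exact/measurable_EFinP.
by apply: eq_measure_integral => A mA _; exact: mu_haar.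
Qed.

Lemma shift_coord_translate j (x : torus R) h : shift_coord j x h =
  translate (fun i => if i == j then \pi_(circle R) h else 0) x.
Proof.
apply: functional_extensionality_dep => i; rewrite shift_coordE /translate.
by case: eqP => [->|]; rewrite ?addr0.
Qed.

Lemma cintegral_shift j h f : bounded_continuous f ->
  cintegral mu (fun x => f (shift_coord j x h)) = cintegral mu f.
Proof.
move=> [cf [M fM]]; have [cR cI] := (continuous_complex f).1 cf.
rewrite /cintegral; congr (_ +i* _).
  rewrite -(Rintegral_translate (fun i => if i == j then \pi_(circle R) h else 0) cR).
    by apply: eq_Rintegral => x _; rewrite shift_coord_translate.
  by exists M => x; apply: le_trans (ler_Re_normc _) (fM x).
rewrite -(Rintegral_translate (fun i => if i == j then \pi_(circle R) h else 0) cI).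
  by apply: eq_Rintegral => x _; rewrite shift_coord_translate.
by exists M => x; apply: le_trans (ler_Im_normc _) (fM x).
Qed.

(** Shifting x_j by [h] preserves the integral but changes the sign of the integrand, so the
    integral equals its own opposite. *)
Lemma cintegral_antiperiodic j (h : R) (u : circle R -> R[i]) K :
  bounded_continuous u -> bounded_continuous K -> indep j K ->
  (forall t, u (t + \pi_(circle R) h) = - u t) ->
  cintegral mu (fun x => u (x j) * K x) = 0.
Proof.
move=> hu hK jK uh.
have hf : bounded_continuous (fun x : torus R => u (x j) * K x).
  by apply: bounded_continuousM => //; exact: bounded_continuous_coord.
have : cintegral mu (fun x => u (x j) * K x) = - cintegral mu (fun x => u (x j) * K x).
  rewrite -{1}(cintegral_shift j h hf) -mulN1r -cintegralZ //.
  congr cintegral; apply/funext => x.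
  by rewrite shift_coordE eqxx uh jK mulN1r mulNr.
move/eqP; rewrite -addr_eq0 -mulr2n mulrn_eq0 /= => /eqP //.
Qed.

End integration.

(** * Fourier coefficients of the example and divergence of their sum *)

Section fourier.
Variables (R : realType) (mu : probability (borel_torus R) R).
Hypothesis mu_haar : is_haar mu.
Implicit Types (K : torus R -> R[i]) (w : nat -> 'I_3).

Lemma expi2piV_bounded_continuous :
  bounded_continuous (fun t : circle R => (expi2pi t)^-1).
Proof.
split; last by exists 1 => t; rewrite normcV normc_expi2pi invr1.
by move=> t; exact: (cvgV (expi2pi_neq0 t) (@continuous_expi2pi R t)).
Qed.

Lemma laurent_bounded_continuous k l :
  bounded_continuous (fun t : circle R => expi2pi t ^+ k * (expi2pi t)^-1 ^+ l).
Proof.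
apply: bounded_continuousM; apply: bounded_continuousX.
  exact: bounded_continuous_expi2pi.
exact: expi2piV_bounded_continuous.
Qed.

(* Translation by [1 / (2 (k - l))] changes the sign of [z^(k - l)]. *)
Lemma cintegral_laurent j K k l : bounded_continuous K -> indep j K -> k != l ->
  cintegral mu (fun x => expi2pi (x j) ^+ k * (expi2pi (x j))^-1 ^+ l * K x) = 0.
Proof.
move=> hK jK kl; pose h : R := (2 * (k%:R - l%:R))^-1.
apply: (cintegral_antiperiodic mu_haar (h := h)
  (laurent_bounded_continuous k l) hK jK) => t.
rewrite expi2piD expi2pi_pi invfM !exprMn mulrACA -(cexpN h) (cexpX h) (cexpX (- h)) -cexpD.
have -> : k%:R * h + l%:R * - h = 2^-1.
  rewrite mulrN -mulrBl /h invfM mulrCA mulfV ?mulr1 //.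
  by rewrite subr_eq0 eqr_nat.
by rewrite cexp_half mulrN1.
Qed.

Lemma trig0_laurent_bounded_continuous l :
  bounded_continuous (fun t : circle R => trig 0 t * (expi2pi t)^-1 ^+ l).
Proof.
apply: bounded_continuousM; first exact: bounded_continuous_trig.
exact/bounded_continuousX/expi2piV_bounded_continuous.
Qed.

(** By orthogonality only the monomial z^l of the polynomial survives. The sum has at most one term;
    for [l = 0] it is empty, which says that [trig 0] has mean zero. *)
Lemma cintegral_trig0 j K l : bounded_continuous K -> indep j K ->
  cintegral mu (fun x => trig 0 (x j) * (expi2pi (x j))^-1 ^+ l * K x) =
  (\sum_(k < 3 | k.+1 == l) coef R k) * cintegral mu K.
Proof.
move=> hK jK.
pose F (k : 'I_3) (x : torus R) : R[i] :=
  coef R k * (expi2pi (x j) ^+ k.+1 * (expi2pi (x j))^-1 ^+ l * K x).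
have hL (k : nat) : bounded_continuous
    (fun x : torus R => expi2pi (x j) ^+ k * (expi2pi (x j))^-1 ^+ l * K x).
  apply: bounded_continuousM => //.
  exact: (bounded_continuous_coord j (laurent_bounded_continuous k l)).
transitivity (cintegral mu (fun x => \sum_k F k x)).
  congr cintegral; apply/funext => x; rewrite /trig !mulr_suml.
  by apply: eq_bigr => k _; rewrite expr0 mulr1 /F !mulrA.
rewrite cintegral_sum => [|k]; last first.
  by apply: bounded_continuousM => //; exact: bounded_continuous_cst.
rewrite mulr_suml [RHS]big_mkcond; apply: eq_bigr => k _.
rewrite /F cintegralZ //; case: eqP => [kl|/eqP kl]; last first.
  by rewrite cintegral_laurent ?mulr0.
congr (_ * cintegral _ _); apply/funext => x.
by rewrite kl -exprMn mulfV ?expi2pi_neq0 // expr1n mul1r.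
Qed.

(** The character e^(-2 pi i p.x) with p_i = w_i + 1 in {1,2,3} for i < N and p_i = 0 beyond. *)
Definition mode w N (x : torus R) : R[i] :=
  \prod_(i < N) (expi2pi (x i))^-1 ^+ (w i).+1.

Lemma bounded_continuous_mode w N : bounded_continuous (mode w N).
Proof.
apply: (bounded_continuous_prod N
  (F := fun i (x : torus R) => (expi2pi (x i))^-1 ^+ (w i).+1)) => i.
apply: (bounded_continuous_coord i (u := fun t => (expi2pi t)^-1 ^+ (w i).+1)).
exact/bounded_continuousX/expi2piV_bounded_continuous.
Qed.

Lemma indep_prod (F : nat -> circle R -> R[i]) N j : (N <= j)%N ->
  indep j (fun x => \prod_(i < N) F i (x i)).
Proof.
move=> Nj x h; apply: eq_bigr => i _; rewrite shift_coordE ifN //.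
by rewrite neq_ltn (leq_trans (ltn_ord i)).
Qed.

Lemma indep_mode w N j : (N <= j)%N -> indep j (mode w N).
Proof. exact: (indep_prod (fun i t => (expi2pi t)^-1 ^+ (w i).+1)). Qed.

Lemma indepM j f K : indep j f -> indep j K -> indep j (fun x : torus R => f x * K x).
Proof. by move=> jf jK x h; rewrite jf jK. Qed.

(** The last variable x_N occurs only in the mode, with nonzero exponent [-(w N).+1], so integration
    in x_N gives 0. *)
Lemma cintegral_mode_indep w N K : bounded_continuous K -> indep N K ->
  cintegral mu (fun x => K x * mode w N.+1 x) = 0.
Proof.
move=> hK NK; rewrite -(@cintegral_laurent N (fun x => K x * mode w N x) 0 (w N).+1) //.
- congr cintegral; apply/funext => x.
  by rewrite /mode big_ord_recr /= expr0 mul1r [RHS]mulrC mulrA.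
- by apply: bounded_continuousM => //; exact: bounded_continuous_mode.
- by apply: indepM => //; exact: indep_mode.
Qed.

(** The variables are removed one at a time, the last first, by [cintegral_trig0]; translation
    invariance does the work of Fubini's theorem. *)
Lemma cintegral_trig0_mode w N :
  cintegral mu (fun x => \prod_(i < N) (trig 0 (x i) * (expi2pi (x i))^-1 ^+ (w i).+1)) =
  \prod_(i < N) coef R (w i).
Proof.
elim: N => [|N IH].
  rewrite big_ord0 -[RHS](cintegral1 mu); congr cintegral.
  by apply/funext => x; rewrite big_ord0.
rewrite big_ord_recr /= -IH mulrC.
pose F i (t : circle R) := trig 0 t * (expi2pi t)^-1 ^+ (w i).+1.
have hF i : bounded_continuous (fun x : torus R => F i (x i)).
  exact: (bounded_continuous_coord i (trig0_laurent_bounded_continuous _)).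
have := @cintegral_trig0 N (fun x => \prod_(i < N) F i (x i)) (w N).+1
  (bounded_continuous_prod N hF) (indep_prod F (leqnn N)).
rewrite (big_pred1 (w N)) => [<-|k]; last by rewrite /= eqSS.
by congr cintegral; apply/funext => x; rewrite big_ord_recr /= mulrC.
Qed.

(* Only the term [n = N] of the series contributes: the shorter ones do not
   depend on the last variable of the mode, and the longer ones contain the
   mean-zero factor [trig 0 (x N)]. *)
Lemma cintegral_example_mode w N :
  cintegral mu (fun x => example x * mode w N.+1 x) = \prod_(i < N.+1) coef R (w i).
Proof.
have [ag _] := trig_admissible0 R.
have bc c : bounded_continuous (fun x => prod_series c (fun=> @trig R 0) x * mode w N.+1 x).
  apply: bounded_continuousM; first exact: prod_series_bounded_continuous.
  exact: bounded_continuous_mode.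
(* The mode has N+1 variables: [c0], [c1] and [c2] keep the lengths below, equal to and above
   N+1. *)
pose c0 := [pred n | predT n & (n <= N)%N].
pose c1 := [pred n | [pred n | predT n & ~~ (n <= N)%N] n & (n <= N.+1)%N].
pose c2 := [pred n | [pred n | predT n & ~~ (n <= N)%N] n & ~~ (n <= N.+1)%N].
transitivity (cintegral mu (fun x => prod_series c0 (fun=> trig 0) x * mode w N.+1 x +
  (prod_series c1 (fun=> trig 0) x * mode w N.+1 x +
   prod_series c2 (fun=> trig 0) x * mode w N.+1 x))).
  congr cintegral; apply/funext => x.
  rewrite /example (prod_seriesID predT (fun n => n <= N)%N x ag).
  by rewrite (prod_seriesID [pred n | predT n & ~~ (n <= N)%N]
    (fun n => n <= N.+1)%N x ag) !mulrDl.
rewrite cintegralD ?cintegralD //; last exact: bounded_continuousD.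
rewrite cintegral_mode_indep ?add0r; last 2 first.
- exact: prod_series_bounded_continuous.
- by apply: indep_prod_series_le => n /andP[].
rewrite [X in _ + X](_ : _ = 0) ?addr0; last first.
  (* Each product kept by [c2] contains [trig 0 (x N.+1)], and neither its other factors nor the
     mode involve that variable; the case [l = 0] of [cintegral_trig0] applies. *)
  pose g := subst (fun=> @trig R 0) N.+1 (fun=> 1).
  have hg : admissible g by apply: admissible_subst => //; exact: bounded_continuous_cst.
  have := @cintegral_trig0 N.+1 (fun x => prod_series c2 g x * mode w N.+1 x) 0.
  rewrite big_pred0 // mul0r => <-.
  - congr cintegral; apply/funext => x; rewrite expr0 mulr1 mulrA; congr (_ * _).
    rewrite -{1}(subst_id (fun=> trig 0) N.+1) prod_series_factor // => n /andP[_].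
    by rewrite -ltnNge.
  - apply: bounded_continuousM; first exact: prod_series_bounded_continuous.
    exact: bounded_continuous_mode.
  - by apply: indepM; [exact: indep_prod_series_subst|exact: indep_mode].
rewrite -cintegral_trig0_mode; congr cintegral; apply/funext => x.
rewrite /prod_series (csum_single (N := N.+1)) => [|n nN]; last first.
  rewrite /term (_ : c1 n = false) ?mul0r //.
  by apply/negbTE; rewrite /c1 /=; lia.
by rewrite /term /= ltnn leqnn mul1r /mode big_split.
Qed.

Lemma normc_coef k : normc (coef R k) = 2 / 5.
Proof.
rewrite /coef normcM normcX /= expr0n expr1n /= add0r sqrtr1 expr1n mulr1.
by rewrite addr0 sqrtr_sqr ger0_norm // divr_ge0.
Qed.

(** A function of the first n coordinates is independent of x_n, so its coefficient at (1, ..., 1)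
    with n+1 ones vanishes; for the example this coefficient is a product of nonzero [coef]
    values. *)
Lemma not_cylindrical_example : ~ cylindrical (@example R).
Proof.
move=> [n [g [_ fE]]]; have jE : indep n (@example R).
  move=> x h; rewrite fE /=; congr g; apply/funext => i.
  by rewrite shift_coordE ifN // neq_ltn ltn_ord.
have [ag _] := trig_admissible0 R.
have := cintegral_mode_indep (fun=> ord0) (prod_series_bounded_continuous predT ag) jE.
rewrite cintegral_example_mode => /(congr1 (@normc R)).
rewrite normc_prod normc0 => /eqP/prodf_eq0[i _].
by rewrite normc_coef mulf_eq0 invr_eq0 !pnatr_eq0.
Qed.

Definition freq N w : Zinf := [fsfun j in [fset j in iota 0 N]%fset => (w j).+1%:Z].

Lemma freqE N w j : freq N w j = if (j < N)%N then (w j).+1%:Z else 0.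
Proof. by rewrite /freq fsfun_fun in_fset mem_iota. Qed.

Lemma expi2pi_sum (I : Type) (s : seq I) (F : I -> circle R) :
  expi2pi (\sum_(i <- s) F i) = \prod_(i <- s) expi2pi (F i).
Proof. exact: (big_morph _ (@expi2piD R) (@expi2pi0 R)). Qed.

Lemma expi2piMn (t : circle R) n : expi2pi (t *+ n) = expi2pi t ^+ n.
Proof.
elim: n => [|n IH]; first by rewrite mulr0n expi2pi0.
by rewrite mulrS expi2piD IH exprS.
Qed.

Lemma expi2pi_dot_freq N w x : expi2pi (- dot (freq N w) x) = mode w N x.
Proof.
rewrite expi2piN /dot expi2pi_sum (perm_big (index_iota 0 N)) /=; last first.
  (* The entries [(w j).+1] are nonzero, so the support is exactly the first [N] indices. *)
  apply: uniq_perm; rewrite ?fset_uniq ?iota_uniq // => j.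
  by rewrite mem_finsupp freqE mem_index_iota /=; case: ltnP.
rewrite big_mkord -prodfV /mode.
apply: eq_bigr => i _; rewrite freqE ltn_ord exprVn.
by rewrite -[_ *~ _]/(x i *+ (w i).+1) expi2piMn.
Qed.

Lemma normc_fourier_coef_example N w :
  normc (fourier_coef mu (@example R) (freq N.+1 w)) = (2 / 5) ^+ N.+1.
Proof.
rewrite /fourier_coef (_ : (fun x => _) = fun x => example x * mode w N.+1 x); last first.
  by apply/funext => x; rewrite expi2pi_dot_freq.
rewrite cintegral_example_mode normc_prod.
by under eq_bigr do rewrite normc_coef; rewrite prodr_const card_ord.
Qed.

(** Finite functions can be enumerated, whereas [freq] takes sequences on all of [nat]; [freq N]
    never reads the default [ord0] past [N]. *)
Definition extend N (v : {ffun 'I_N -> 'I_3}) : nat -> 'I_3 :=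
  fun j => oapp v ord0 (insub j).

Lemma extendE N (v : {ffun 'I_N -> 'I_3}) (i : 'I_N) : extend v i = v i.
Proof. by rewrite /extend valK. Qed.

Lemma freq_extend_inj N : injective (fun v : {ffun 'I_N -> 'I_3} => freq N (extend v)).
Proof.
move=> u v /= /fsfunP uv; apply/ffunP => i; have := uv i.
by rewrite !freqE ltn_ord !extendE => -[] /val_inj.
Qed.

Lemma sum_fourier_coef_example N :
  (((6 / 5) ^+ N.+1)%:E <=
   \esum_(p in [set: Zinf]) (normc (fourier_coef mu (@example R) p))%:E)%E.
Proof.
pose r := [seq freq N.+1 (extend v) | v <- enum {ffun 'I_N.+1 -> 'I_3}].
(* A sum of nonnegative terms dominates its finite subsums; injectivity of [v] to frequency ensures
   that 3^(N+1) distinct terms are counted. *)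
apply: esum_ge; exists [set` r]; first by split=> //; exact: finite_seq.
rewrite -fsbig_seq; last by rewrite map_inj_uniq ?enum_uniq //; exact: freq_extend_inj.
rewrite big_map big_enum (eq_bigr (fun=> ((2 / 5) ^+ N.+1)%:E)); last first.
  by move=> v _; rewrite normc_fourier_coef_example.
rewrite sumEFin sumr_const card_ffun !card_ord lee_fin.
rewrite -[leRHS]mulr_natl natrX -exprMn; have -> : 3 * (2 / 5) = 6 / 5 :> R by lra.
exact: lexx.
Qed.

Lemma esum_fourier_coef_example :
  (\esum_(p in [set: Zinf]) (normc (fourier_coef mu (@example R) p))%:E)%E = +oo%E.
Proof.
(* Bernoulli's inequality for 6/5 = 1 + 1/5 gives linear growth, so any [n] with 5y <= n suffices to
   exceed [y]. *)
apply/eq_infty => y; have bernoulli n : 1 + n%:R / 5 <= (6 / 5) ^+ n :> R.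
  elim: n => [|n IH]; first by rewrite mul0r addr0 expr0.
  rewrite exprS -[n.+1]addn1 natrD; have := ler0n R n; nra.
have [n yn] : exists n : nat, 5 * y <= n%:R.
  exists (Num.truncn `|5 * y|).+1.
  apply: le_trans (ler_norm _) (ltW _); exact: truncnS_gt.
apply: le_trans (sum_fourier_coef_example n); rewrite lee_fin.
apply: le_trans (bernoulli n.+1); rewrite -[n.+1]addn1 natrD; lra.
Qed.

End fourier.

Theorem theorem1p4 (R : realType) (mu : probability (borel_torus R) R)
    (mu_haar : is_haar mu) :
  exists f : torus R -> R[i],
    [/\ classCinfty f,
        ~ cylindrical f &
        (\esum_(p in [set: Zinf])
           (ComplexField.Normc.normc (fourier_coef mu f p))%:E = +oo)%E].
Proof.
exists (@example R); split.
- exact: classCinfty_example.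
- exact: not_cylindrical_example mu_haar.
- exact: esum_fourier_coef_example.
Qed.
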